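(* Let $Z_i=(X_i,Y_i)$, $i=1,\dots,n+1$, be i.i.d., let the training mechanism be permutation invariant, let $\theta_n$ be trained on $D_n=(Z_i)_{i\le n}$ and $\theta_{n+1}$ on $D_{n+1}=(Z_i)_{i\le n+1}$ (on a common probability space), and define $S_i^{(n)}=s(Z_i;\theta_n)$, $S_i^{(n+1)}=s(Z_i;\theta_{n+1})$. Fix $\alpha\in(0,1)$, $r=\lceil(1-\alpha)(n+1)\rceil$, and let $q_*$ be the $r$-th smallest of $S_1^{(n+1)},\dots,S_{n+1}^{(n+1)}$. Assume: (A1) there are $u_n>0$, $\delta_n\in(0,1)$ with $\mathbb P(\|\theta_{n+1}-\theta_n\|_2>u_n)\le\delta_n$; (A2) $|s(Z;\theta)-s(Z;\theta')|\le L\|\theta-\theta'\|_2$ for all $Z$ and all $\theta,\theta'$; (A3) $\mathbb P(S_i^{(n+1)}=S_j^{(n+1)})=0$ for all $i\ne j$; (A4) there are $\overline f<\infty$ and $\rho>0$ such that for all $\delta\in(0,\rho]$ and all $i\in\{1,\dots,n+1\}$: $\mathbb P(q_*<S_i^{(n+1)}\le q_*+\delta)\le\overline f\delta$ and $\mathbb P(q_*-\delta\le S_i^{(n+1)}<q_* )\le\overline f\delta$. Run Algorithm 2 on $S_1^{(n)},\dots,S_n^{(n)}$ with failure probability $\beta=\beta_n\in(0,1)$, range upper end $b\ge\max_{i\le n}S_i^{(n)}$, and buffer $m_n=\lceil n\overline f L u_n/\delta_n\rceil$, and assume $Lu_n\le\rho$ and $r+m_n\le n$. Then its output $\hat q$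 satisfies $$\mathbb P\big(S_{n+1}^{(n)}\le\hat q\big)\ge(1-\beta_n)\Big(1-\alpha-2\overline fLu_n-3\delta_n-\tfrac1{n+1}\Big).$$
   Context: Algorithm 2 (Buffered DP Right-Endpoint Binary Search) on scores $S_1,\dots,S_n$ with range $[a,b]$, level $\alpha$, buffer $m_n$, steps $N$, noise $\sigma>0$, failure probability $\beta$: set $r=\lceil(1-\alpha)(n+1)\rceil$, $\tau=\sigma\Phi^{-1}(1-\beta/N)-1$, $r'=r+m_n+\tau$, $\texttt{left}=a$, $\texttt{right}=b$; for $k=1,\dots,N$: $\texttt{mid}=(\texttt{left}+\texttt{right})/2$, $\tilde C_k=\#\{i\le n:S_i\le\texttt{mid}\}+Z_k$ with $Z_k\sim\mathcal N(0,\sigma^2)$ independent of the data, the models and previous noise; if $\tilde C_k\ge r'$ set $\texttt{right}=\texttt{mid}$ else $\texttt{left}=\texttt{mid}$; output $\hat q=\texttt{right}$. $\Phi$ is the standard normal CDF. $s(Z;\theta)$ is a fixed non-conformity score; a training mechanism is permutation invariant if its output distribution is invariant to reordering the input data. *)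

(* Defs.v *)
From HB Require Import structures.
From mathcomp Require Import all_boot all_order all_algebra fingroup perm.
From mathcomp Require Import all_classical all_reals all_analysis.
Set Implicit Arguments. Unset Strict Implicit. Unset Printing Implicit Defensive.
Import Order.TTheory GRing.Theory Num.Theory.
Local Open Scope classical_set_scope.
Local Open Scope ring_scope.

Section defs.
Context {R : realType}.

Definition l2norm (p : nat) (v : 'rV[R]_p) : R :=
  Num.sqrt (\sum_(j < p) v ord0 j ^+ 2).

Definition rV_borel (p : nat) : set (set 'rV[R]_p) :=
  <<s [set E | exists (j : 'I_p) (B : set R),
          measurable B /\ E = (fun v : 'rV[R]_p => v ord0 j) @^-1` B] >>.

Definition cyl_salg d (T : measurableType d) (m : nat) : set (set ('I_m -> T)) :=
  <<s [set E | exists (i : 'I_m) (B : set T),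
          measurable B /\ E = (fun D : 'I_m -> T => D i) @^-1` B] >>.

Definition prod_salg (X Y : Type) (F : set (set X)) (G : set (set Y))
  : set (set (X * Y)) :=
  <<s [set E | exists A B, F A /\ G B /\ E = A `*` B] >>.

Definition rv_salg (Omega : Type) d (T : measurableType d) (X : Omega -> T)
  : set (set Omega) :=
  [set E | exists B, measurable B /\ E = X @^-1` B].

Definition rvec_salg (Omega : Type) (p : nat) (X : Omega -> 'rV[R]_p)
  : set (set Omega) :=
  [set E | exists B, rV_borel B /\ E = X @^-1` B].

Definition mutually_independent d (Omega : measurableType d)
  (P : probability Omega R) (I : finType) (F : I -> set (set Omega)) : Prop :=
  forall (J : {set I}) (E : I -> set Omega),
    (forall i, i \in J -> F i (E i)) ->
    P (\big[setI/setT]_(i in J) E i) = (\prod_(i in J) P (E i))%E.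

Definition Phi (x : R) : R := fine (normal_prob 0 1 `]-oo, x]).
Definition Phiinv (u : R) : R := inf [set x | u <= Phi x].

Definition kth_smallest (m : nat) (x : 'I_m -> R) (k : nat) : R :=
  nth 0 (sort <=%R [seq x i | i <- enum 'I_m]) k.-1.

Definition conf_rank (alpha : R) (n : nat) : nat :=
  `|Num.ceil ((1 - alpha) * n.+1%:R)|%N.

Definition bs_step (n : nat) (S : 'I_n -> R) (r' : R) (lr : R * R) (z : R)
  : R * R :=
  let mid := (lr.1 + lr.2) / 2 in
  if r' <= #|[set i | S i <= mid]|%:R + z then (lr.1, mid) else (mid, lr.2).

(* Algorithm 2: Buffered DP right-endpoint binary search.
   w k is the noise Z_{k+1} ~ N(0, sigma^2) of step k+1. *)
Definition buffered_dp_rbs (n : nat) (S : 'I_n -> R) (a b alpha : R)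
  (m N : nat) (sigma beta : R) (w : 'I_N -> R) : R :=
  let r := conf_rank alpha n in
  let tau := sigma * Phiinv (1 - beta / N%:R) - 1 in
  let r' := r%:R + m%:R + tau in
  (foldl (bs_step S r') (a, b) [seq w k | k <- enum 'I_N]).2.

End defs.

Arguments buffered_dp_rbs {R n} S a b alpha m N sigma beta w.
Arguments cyl_salg {d} T m.
Arguments prod_salg {X Y} F G.
Arguments rv_salg {Omega d T} X.
Arguments rvec_salg {R Omega p} X.
Arguments rV_borel {R} p.

(* Main.v *)
(** Write x_i and y_i for the scores under theta_{n+1} and theta_n, and q for the
    r-th smallest x_i. If all noises stay below sigma * Phi^-1 (1 - beta/N), which
    has probability at least (1 - beta/N)^N >= 1 - beta, the right endpoint of the
    search always has at least r + m_n of the y_i, i <= n, at or below it.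
    Hence y_{n+1} <= qhat on the intersection of this event with
    E := {fewer than r + m_n of the y_i, i <= n, lie below y_{n+1}}; the two
    are independent, so it remains to bound P(E).
    Put h = L u_n. If theta_n and theta_{n+1} are u_n-close, there are no ties,
    x_{n+1} < q - h and at most m_n of the x_i lie in (q, q + h], then E holds,
    because y_i < y_{n+1} forces x_i < q + h. Markov's inequality bounds the
    probability of more than m_n points in (q, q + h], and exchangeability of the
    x_i gives P(x_{n+1} < q) >= (r - 1) / (n + 1). *)
Require Import Defs.
From HB Require Import structures.
From mathcomp Require Import all_boot all_order all_algebra fingroup perm.
From mathcomp Require Import all_classical all_reals all_analysis.
From mathcomp Require Import measurable_realfun ring lra.
Set Implicit Arguments. Unset Strict Implicit. Unset Printing Implicit Defensive.
Import Order.TTheory GRing.Theory Num.Theory.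
Import numFieldNormedType.Exports.
Local Open Scope classical_set_scope.
Local Open Scope ring_scope.

(** * Order statistics *)

(** A downward closed predicate holds on an initial segment of the sorted list, so it holds at
    position [k.-1] exactly when that segment has length at least [k]. Taking a general [a] covers
    both [<= c] and [< c]. *)
Lemma kth_smallestE {R : realType} (m k : nat) (x : 'I_m -> R) (a : pred R) :
  (forall u v, u <= v -> a v -> a u) -> (0 < k <= m)%N ->
  a (kth_smallest x k) = (k <= #|[pred i | a (x i)]|)%N.
Proof.
move=> adown /andP[k0 km]; rewrite /kth_smallest.
set s := sort _ _.
have szs : size s = m by rewrite size_sort size_map size_enum_ord.
have -> : #|[pred i | a (x i)]| = count a s.
  by rewrite (seq.permP (permEl (perm_sort _ _))) count_map cardE enumT size_filter.
have ss : sorted <=%R s by exact: sort_le_sorted.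
have sn i j : (i <= j)%N -> (j < m)%N -> nth 0 s i <= nth 0 s j.
  move=> ij jm; apply: (sorted_leq_nth le_trans le_refl 0 ss) => //.
    by rewrite inE szs (leq_ltn_trans ij jm).
  by rewrite inE szs.
have k1m : (k.-1 < m)%N by rewrite prednK.
apply/idP/idP => [ak|].
  rewrite -(cat_take_drop k s) count_cat.
  suff -> : count a (take k s) = k by exact: leq_addr.
  have szt : size (take k s) = k by rewrite size_takel// szs.
  rewrite -[RHS]szt; apply/eqP; rewrite -all_count.
  apply/(all_nthP 0) => i; rewrite szt => ik.
  rewrite nth_take//; apply: adown ak.
  by apply: sn => //; rewrite -ltnS prednK.
apply: contraLR => nak; rewrite -ltnNge.
rewrite -(cat_take_drop k.-1 s) count_cat.
suff -> : count a (drop k.-1 s) = 0%N.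
  rewrite addn0; apply: leq_ltn_trans (count_size _ _) _.
  by rewrite size_takel ?szs 1?(ltnW k1m)// prednK.
apply/eqP; rewrite eqn0Ngt -has_count; apply/hasPn => y /(nthP 0)[j].
rewrite size_drop szs ltn_subRL => jm <-; rewrite nth_drop.
apply: contra nak; apply: adown; apply: sn; rewrite ?leq_addr//.
Qed.

Lemma kth_smallest_le {R : realType} (m k : nat) (x : 'I_m -> R) (c : R) :
  (0 < k <= m)%N -> (kth_smallest x k <= c) = (k <= #|[pred i | (x i <= c)%R]|)%N.
Proof.
by move=> km; rewrite (@kth_smallestE R m k x (fun y => y <= c))// => u v; exact: le_trans.
Qed.

Lemma kth_smallest_lt {R : realType} (m k : nat) (x : 'I_m -> R) (c : R) :
  (0 < k <= m)%N -> (kth_smallest x k < c) = (k <= #|[pred i | (x i < c)%R]|)%N.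
Proof.
by move=> km; rewrite (@kth_smallestE R m k x (fun y => y < c))// => u v; exact: le_lt_trans.
Qed.

Lemma kth_smallest_perm {R : realType} (m k : nat) (x : 'I_m -> R) (pi : 'S_m) :
  kth_smallest (fun i => x (pi i)) k = kth_smallest x k.
Proof.
rewrite /kth_smallest; congr nth.
apply/perm_sortP; [exact: le_total|exact: le_trans|exact: le_anti|].
rewrite (map_comp x pi); apply: perm_map; apply: uniq_perm.
- by rewrite map_inj_uniq ?enum_uniq//; exact: perm_inj.
- exact: enum_uniq.
- move=> i; rewrite mem_enum; apply/mapP; exists ((pi^-1)%g i).
    by rewrite mem_enum.
  by rewrite permKV.
Qed.

Section injective_sample.
Context {R : realType} (m k : nat) (x : 'I_m -> R).
Hypotheses (km : (0 < k <= m)%N) (xinj : injective x).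
Let q := kth_smallest x k.

Let card_eq_le1 : (#|[pred i | (x i == q)%R]| <= 1)%N.
Proof.
apply/card_le1_eqP => i j; rewrite !inE => /eqP xi /eqP xj.
by apply: xinj; rewrite xi xj.
Qed.

Let card_le_split :
  #|[pred i | (x i <= q)%R]| = (#|[pred i | (x i < q)%R]| + #|[pred i | (x i == q)%R]|)%N.
Proof.
rewrite -cardUI [X in (_ = _ + X)%N]eq_card0 ?addn0.
  by apply: eq_card => i; rewrite !inE le_eqVlt orbC.
by move=> i; rewrite !inE; case: ltgtP.
Qed.

(** At least [k] entries are at or below [q], and by injectivity at most one of them equals [q]. *)
Lemma card_lt_kth_smallest : (k <= #|[pred i | (x i < q)%R]|.+1)%N.
Proof.
have : (k <= #|[pred i | (x i <= q)%R]|)%N by rewrite -kth_smallest_le.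
by rewrite card_le_split => /leq_trans; apply; rewrite -addn1 leq_add2l card_eq_le1.
Qed.

Lemma card_le_kth_smallest : (#|[pred i | (x i <= q)%R]| <= k)%N.
Proof.
have : ~~ (k <= #|[pred i | (x i < q)%R]|)%N by rewrite -kth_smallest_lt// ltxx.
rewrite -ltnNge card_le_split => h; apply: (@leq_trans (#|[pred i | (x i < q)%R]| + 1)).
  by rewrite leq_add2l card_eq_le1.
by rewrite addn1.
Qed.

End injective_sample.

(** The deterministic core. If [y i < y ord_max], then [x i <= y i + h < y ord_max + h <= x ord_max
    + 2 h < q + h], so [x i] is either at most [q] or in the band above [q]. *)
Lemma card_perturbed_lt {R : realType} (n k M : nat) (x y : 'I_n.+1 -> R) (h : R) :
  (0 < k <= n.+1)%N -> injective x -> 0 <= h ->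
  (forall i, `|y i - x i| <= h) ->
  let q := kth_smallest x k in
  x ord_max < q - h ->
  (#|[pred i : 'I_n | (q < x (widen_ord (leqnSn n) i) <= q + h)%R]| <= M)%N ->
  (#|[pred i : 'I_n | (y (widen_ord (leqnSn n) i) < y ord_max)%R]| < k + M)%N.
Proof.
move=> km xinj h0 yx q xq hM.
pose w := widen_ord (leqnSn n).
have winj : injective w by move=> i j /(congr1 val) /= /val_inj.
have wmax i : w i != ord_max by rewrite -val_eqE /= ltn_eqF.
have card : (#|[pred i : 'I_n | (y (w i) < y ord_max)%R]| <=
    #|[pred i : 'I_n | (x (w i) <= q)%R]| +
    #|[pred i : 'I_n | (q < x (w i) <= q + h)%R]|)%N.
  rewrite -cardUI; apply: leq_trans (leq_addr _ _).
  apply: subset_leq_card; apply/fintype.subsetP => i; rewrite !inE => yi.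
  have := yx (w i); have := yx ord_max; rewrite !ler_distl.
  move=> /andP[_ ym] /andP[yw _].
  by case: leP => //= _; move: yi ym yw xq; lra.
apply: leq_ltn_trans (leq_trans card (leq_add (leqnn _) hM)) _.
rewrite ltn_add2r.
have := card_le_kth_smallest km xinj; rewrite -/q; apply: leq_trans.
(* The index [ord_max] is itself among the at most [k] indices with [x i <= q]. Removing it leaves
   at most [k - 1] among the first [n], which makes the final inequality strict. *)
rewrite (cardD1 ord_max) inE -/q.
have -> : x ord_max <= q by move: xq h0; lra.
rewrite add1n ltnS -(fintype.card_image winj).
apply: subset_leq_card; apply/fintype.subsetP => j /fintype.imageP[i].
by rewrite !inE => xi ->; rewrite wmax.
Qed.

(** * Normal quantiles *)

Section normal_quantile.
Context {R : realType}.
Implicit Types (sigma x u : R).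

(** Substitution along [F y = sigma * y]; the derivative [sigma] cancels the factor [1 / sigma] of
    the normalising constant. *)
Lemma normal_prob_scale sigma x : 0 < sigma ->
  normal_prob 0 sigma `]-oo, sigma * x] = normal_prob 0 1 `]-oo, x].
Proof.
move=> s0; have sn0 : sigma != 0 by rewrite gt_eqF.
rewrite /normal_prob.
pose F := fun y : R => sigma * y.
have derF (y : R) : derivable F y 1 by apply: derivableM.
have dF : F^`()%classic = cst sigma.
  apply/funext => y; rewrite derive1E /F deriveM// derive_cst scaler0 addr0.
  by rewrite derive_id /GRing.scale/= mulr1.
have cF : continuous F by move=> y; exact: mulrl_continuous.
rewrite (@increasing_ge0_integration_by_substitutionNy _ F).
- apply: eq_integral => y _; rewrite dF /= /F !normal_pdfE ?oner_eq0//.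
  rewrite /normal_fun /normal_peak; congr EFin.
  change ((Num.sqrt (sigma ^+ 2 * pi *+ 2))^-1 *
    expR (- (sigma * y - 0) ^+ 2 / (sigma ^+ 2 *+ 2)) * sigma =
   (Num.sqrt (1 ^+ 2 * pi *+ 2))^-1 * expR (- (y - 0) ^+ 2 / (1 ^+ 2 *+ 2))).
  rewrite mulrAC; congr (_ * expR _); last by field.
  rewrite expr1n mul1r -mulrnAr sqrtrM ?sqr_ge0// sqrtr_sqr gtr0_norm//.
  by rewrite invfM mulrAC mulVf// mul1r.
- by move=> y z _ _; rewrite /F ltr_pM2l.
- by move=> y _; rewrite dF; exact: cvg_cst.
- by rewrite dF; exact: is_cvg_cst.
- by rewrite dF; exact: cvg_cst.
- by split=> [y _|]; [exact: derF|exact/cvg_at_left_filter/cF].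
- exact: gt0_cvgMrNy.
- exact/continuous_subspaceT/continuous_normal_pdf.
- by move=> y _; exact: normal_pdf_ge0.
Qed.

(** The identity, seen as a random variable under the standard normal law, makes [Phi] a
    distribution function in the sense of [cdf]. *)
Let idRV : measurableTypeR R -> R := idfun.

#[local] HB.instance Definition _ :=
  @isMeasurableFun.Build _ _ _ _ idRV (@measurable_id _ _ setT).

Let N01 : probability (measurableTypeR R) R := normal_prob 0 1.
Let X : {RV N01 >-> R} := idRV.

Let PhiE x : Phi x = fine (cdf X x).
Proof. by rewrite /Phi /cdf /distribution /pushforward preimage_id. Qed.

Let cdfE x : cdf X x = (Phi x)%:E.
Proof. by rewrite PhiE fineK// fin_num_measure. Qed.

Let Phi_nd x y : x <= y -> Phi x <= Phi y.
Proof. by move=> xy; rewrite -lee_fin -!cdfE cdf_nondecreasing. Qed.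

(** The infimum defining [Phiinv] is attained. The limits of [Phi] at both infinities make the set
    nonempty and bounded below, and right continuity carries the bound to its infimum. *)
Lemma Phi_Phiinv_ge u : 0 < u < 1 -> u <= Phi (Phiinv u).
Proof.
move=> /andP[u0 u1].
pose S := [set x : R | u <= Phi x].
have Phiy : Phi x @[x --> +oo] --> (1 : R).
  apply: cvg_trans (fine_cvg (@cvg_cdfy1 _ _ _ _ X)).
  by apply: near_eq_cvg; near=> x; rewrite /= PhiE.
have PhiNy : Phi x @[x --> -oo] --> (0 : R).
  apply: cvg_trans (fine_cvg (@cvg_cdfNy0 _ _ _ _ X)).
  by apply: near_eq_cvg; near=> x; rewrite /= PhiE.
have Sinf : has_inf S.
  split.
    have [M [_ /(_ (M + 1))]] := cvgr_ge _ Phiy _ u1.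
    by rewrite ltrDl ltr01 => /(_ isT) uM; exists (M + 1).
  have [M [_ hM]] := cvgr_lt _ PhiNy _ u0.
  exists (M - 1) => y; rewrite /S/= => uy; rewrite leNgt; apply/negP => yM.
  have : Phi (M - 1) < u by apply: hM; rewrite ltrBlDr ltrDl.
  by rewrite ltNge (le_trans uy)// Phi_nd// ltW.
rewrite -lee_fin -cdfE.
have := @cdf_right_continuous _ _ _ _ X (Phiinv u).
apply: cvge_ge; near=> x; rewrite cdfE lee_fin.
(* Every point right of the infimum lies above some point of [S], so monotonicity gives [u <= Phi x]
   there. *)
have x0 : 0 < x - Phiinv u by rewrite subr_gt0; near: x; exact: nbhs_right_gt.
have [y Sy] := inf_adherent x0 Sinf.
by rewrite addrC -/(Phiinv u) subrK => /ltW/Phi_nd; exact: le_trans.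
Unshelve. all: by end_near. Qed.

End normal_quantile.

(** * Measurability of counts and of the search *)

Section measurable_cardinality.
Context {d : measure_display} {X : measurableType d} (I : finType).
Variables (b : I -> X -> bool) (k : nat).
Hypothesis mb : forall i, measurable [set x | b i x].

Lemma measurable_set_card_ge : measurable [set x | (k <= #|[pred i | b i x]|)%N].
Proof.
have -> : [set x | (k <= #|[pred i | b i x]|)%N] =
    \bigcup_(J in [set J : {set I} | (k <= #|J|)%N])
      \bigcap_(i in [set i | i \in J]) [set x | b i x].
  apply/seteqP; split => x /=.
    move=> kb; exists (finset (fun i => b i x)); first by rewrite /= cardsE.
    by move=> i; rewrite /= inE.
  move=> [J /= kJ Jb]; apply: leq_trans kJ _.
  by apply: subset_leq_card; apply/fintype.subsetP => i iJ; rewrite inE; exact: Jb.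
apply: fin_bigcup_measurable => [|J _]; first exact: finite_finset.
by apply: fin_bigcap_measurable => [|i _]; [exact: finite_finset|exact: mb].
Qed.

Lemma measurable_set_card_lt : measurable [set x | (#|[pred i | b i x]| < k)%N].
Proof.
have -> : [set x | (#|[pred i | b i x]| < k)%N] =
    ~` [set x | (k <= #|[pred i | b i x]|)%N].
  by apply/seteqP; split => x /=; rewrite ltnNge => /negP.
exact/measurableC/measurable_set_card_ge.
Qed.

End measurable_cardinality.

Section measurability.
Context {R : realType} {d : measure_display} {X : measurableType d}.
Implicit Types f g : X -> R.

Lemma measurable_set_le f g : measurable_fun setT f -> measurable_fun setT g ->
  measurable [set x | f x <= g x].
Proof. by move=> mf mg; rewrite -[X in measurable X]setTI; exact: measurable_fun_le. Qed.

Lemma measurable_set_lt f g : measurable_fun setT f -> measurable_fun setT g ->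
  measurable [set x | f x < g x].
Proof.
move=> mf mg; rewrite (_ : [set x | _] = ~` [set x | g x <= f x]).
  exact/measurableC/measurable_set_le.
by apply/seteqP; split=> x /=; rewrite ltNge => /negP.
Qed.

Lemma card_indic (I : finType) (b : I -> X -> bool) x :
  #|[pred i | b i x]|%:R = \sum_i \1_[set y | b i y] x :> R.
Proof.
rewrite -sum1_card natr_sum big_mkcond/=.
apply: eq_bigr => i _; rewrite inE indicE; case: ifPn => bi.
  by rewrite mem_set.
by rewrite memNset//; exact/negP.
Qed.

Lemma measurable_card (I : finType) (b : I -> X -> bool) :
  (forall i, measurable [set x | b i x]) ->
  measurable_fun setT (fun x => #|[pred i | b i x]|%:R : R).
Proof.
move=> mb; under eq_fun do rewrite card_indic.
by apply: measurable_sum => i; exact: measurable_indic.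
Qed.

Lemma measurable_kth_smallest (m k : nat) (f : 'I_m -> X -> R) :
  (0 < k <= m)%N -> (forall i, measurable_fun setT (f i)) ->
  measurable_fun setT (fun x => kth_smallest (fun i => f i x) k).
Proof.
move=> km mf; apply: (measurability _ (RGenInftyO.measurableE R)).
move=> _ [_ [c ->] <-]; rewrite setTI.
have -> : (fun x => kth_smallest (f^~ x) k) @^-1` `]-oo, c[ =
    [set x | (k <= #|[pred i | (f i x < c)%R]|)%N].
  by apply/seteqP; split => x /=; rewrite in_itv/= kth_smallest_lt.
by apply: measurable_set_card_ge => i; exact: measurable_set_lt.
Qed.

End measurability.

(** Links the classical set counted by [bs_step] to the boolean predicates counted elsewhere. *)
Lemma card_classical_set (I : finType) (b : pred I) :
  #|[set i | b i]%classic| = #|[pred i | b i]|.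
Proof.
apply: eq_card => i; rewrite [RHS]inE.
by apply/idP/idP => [/set_mem //|bi]; exact/mem_set.
Qed.

(** * The binary search under bounded noise *)

Section binary_search.
Context {R : realType} (n N : nat).

(* A noisy count reaching r' certifies a true count above k - 1, hence, being an
   integer, at least k. *)
Lemma bs_step_right_card (S : 'I_n -> R) (r' : R) (k : nat) (lr : R * R) (z : R) :
  (k <= #|[pred i | (S i <= lr.2)%R]|)%N -> z < r' - k%:R + 1 ->
  (k <= #|[pred i | (S i <= (bs_step S r' lr z).2)%R]|)%N.
Proof.
move=> hk hz; rewrite /bs_step card_classical_set.
case: ifPn => //= hr; rewrite -ltnS -(ltr_nat R) -[X in _ < X]natr1.
by move: hz hr; lra.
Qed.

(** The count at the right endpoint is an invariant: at [b] it equals [n], and each step preserves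
    the lower bound. *)
Lemma buffered_dp_rbs_card (S : 'I_n -> R) (a b alpha : R) (m : nat)
    (sigma beta : R) (w : 'I_N -> R) :
  (forall i, S i <= b) -> (conf_rank alpha n + m <= n)%N ->
  (forall k, w k < sigma * Phiinv (1 - beta / N%:R)) ->
  (conf_rank alpha n + m <=
    #|[pred i | (S i <= buffered_dp_rbs S a b alpha m N sigma beta w)%R]|)%N.
Proof.
move=> Sb rmn hw; rewrite /buffered_dp_rbs.
set r' := _ + _ + _.
have : (conf_rank alpha n + m <= #|[pred i | (S i <= (a, b).2)%R]|)%N.
  by rewrite eq_cardT -?cardE ?card_ord// => i; rewrite inE Sb.
elim: (enum 'I_N) (a, b) => //= k s IH lr hlr; apply/IH/bs_step_right_card => //.
(* Here [r' - (r + m) + 1] is exactly [sigma * Phiinv (1 - beta / N)]: the [- 1] in [tau] is paid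
   for by the integrality of the count. *)
by rewrite /r' natrD; have := hw k; lra.
Qed.

Context {d : measure_display} {X : measurableType d}.

Lemma measurable_buffered_dp_rbs (S : 'I_n -> X -> R) (a b alpha : R) (m : nat)
    (sigma beta : R) (w : 'I_N -> X -> R) :
  (forall i, measurable_fun setT (S i)) -> (forall k, measurable_fun setT (w k)) ->
  measurable_fun setT
    (fun x => buffered_dp_rbs (S^~ x) a b alpha m N sigma beta (w^~ x)).
Proof.
move=> mS mw; rewrite /buffered_dp_rbs.
set r' := _ + _ + _.
(* After one step the endpoints depend on the outcome, so the induction runs over arbitrary
   measurable starting endpoints. *)
suff H (s : seq 'I_N) (f g : X -> R) : measurable_fun setT f -> measurable_fun setT g ->
    measurable_fun setT (fun x =>
      (foldl (bs_step (S^~ x) r') (f x, g x) [seq w k x | k <- s]).2).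
  exact: (H _ (cst a) (cst b)).
elim: s f g => //= k s IH f g mf mg.
pose mid x := (f x + g x) / 2.
pose c x := r' <= #|[pred i | S i x <= mid x]|%:R + w k x.
have mmid : measurable_fun setT mid.
  by apply: measurable_funM => //; exact: measurable_funD.
have mc : measurable_fun setT c.
  apply: measurable_fun_ler => //; apply: measurable_funD => //.
  by apply: measurable_card => i; exact: measurable_set_le.
apply: eq_measurable_fun
  (IH _ _ (measurable_fun_ifT mc mf mmid) (measurable_fun_ifT mc mmid mg)).
move=> x _; rewrite /bs_step card_classical_set /=.
by rewrite -/(mid x) -/(c x); case: (c x).
Qed.

End binary_search.

(** The strict inequality matches the noise bound of [bs_step_right_card]. The open and closed
    half-lines have equal mass because the normal law is absolutely continuous. *)
Lemma normal_prob_lt_quantile {R : realType} (sigma u : R) : 0 < sigma -> 0 < u < 1 ->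
  (u%:E <= normal_prob 0 sigma [set x | (x < sigma * Phiinv u)%R])%E.
Proof.
move=> s0 u01; set c := sigma * _.
have -> : normal_prob 0 sigma [set x | x < c] = normal_prob 0 sigma `]-oo, c].
  have -> : [set x | x < c] = `]-oo, c[%classic by apply/seteqP; split => x /=; rewrite in_itv.
  rewrite -(@setUitv1 _ _ -oo%O c true)//= measureU//=; last first.
    by apply/seteqP; split => x //= [] /[swap] ->; rewrite in_itv/= ltxx.
  have /null_content_dominatesP dom := normal_prob_dominates 0 sigma.
  by rewrite (dom [set c]) ?adde0//; exact: lebesgue_measure_set1.
rewrite normal_prob_scale// -[leRHS]fineK ?fin_num_measure// lee_fin.
exact: Phi_Phiinv_ge.
Qed.

(** * Exchangeability of i.i.d. samples *)

(** Markov's inequality for a count: [k] times the indicator of [G] is dominated by the sum of the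
    indicators, and both sides are integrated. *)
Lemma prob_card_markov {R : realType} {d : measure_display} {X : measurableType d}
    (P : probability X R) (I : finType) (b : I -> X -> bool) (G : set X) (k : nat) :
  (forall i, measurable [set x | b i x]) -> measurable G ->
  (forall x, G x -> (k <= #|[pred i | b i x]|)%N) ->
  ((k%:R)%:E * P G <= \sum_i P [set x | b i x])%E.
Proof.
move=> mb mG Gk.
have -> : (\sum_i P [set x | b i x] = \int[P]_x \sum_i (\1_[set x | b i x] x)%:E)%E.
  rewrite ge0_integral_sum//; last by move=> i; apply/measurable_EFinP/measurable_indic.
  by apply: eq_bigr => i _; rewrite integral_indic// setIT.
have -> : ((k%:R)%:E * P G = \int[P]_x (k%:R * \1_G x)%:E)%E.
  under eq_integral do rewrite EFinM.
  rewrite ge0_integralZl//; last exact/measurable_EFinP/measurable_indic.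
  by rewrite integral_indic// setIT.
apply: ge0_le_integral => //.
- by apply/measurable_EFinP/measurable_funM => //; exact: measurable_indic.
- by apply: emeasurable_sum => i; exact/measurable_EFinP/measurable_indic.
move=> x _; rewrite sumEFin lee_fin.
rewrite -card_indic indicE; case: (pselect (G x)) => Gx.
  by rewrite mem_set// mulr1 ler_nat Gk.
by rewrite memNset// mulr0.
Qed.

Definition cylinders {d} (T : measurableType d) (m : nat) : set (set ('I_m -> T)) :=
  [set E | exists (i : 'I_m) (B : set T),
     measurable B /\ E = (fun D : 'I_m -> T => D i) @^-1` B].

Arguments cylinders {d} T m.

(* 'I_m -> T with the sigma-algebra [cyl_salg T m] of the statement. *)
Notation funT T m := (g_sigma_algebraType (cylinders T m)).

Section cylinder_sigma_algebra.
Context {dT} {T : measurableType dT} {dU} {U : measurableType dU} {m : nat}.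

Lemma measurable_coord (i : 'I_m) : measurable_fun setT (fun D : funT T m => D i).
Proof.
by move=> _ B mB; rewrite setTI; apply: sub_sigma_algebra; exists i, B.
Qed.

Lemma measurable_fun_coordP {dX} {X : measurableType dX} (f : X -> funT T m) :
  (forall i, measurable_fun setT (fun x => f x i)) -> measurable_fun setT f.
Proof.
move=> mf; apply: (@measurability _ _ X (funT T m) setT f _ erefl) => _ [_ [i [B [mB ->]]] <-].
by apply: (mf i).
Qed.

Definition box (B : 'I_m -> set T) (C : set U) : set (funT T m * U) :=
  [set x | (forall i, B i (x.1 i)) /\ C x.2].

(** The pi-system on which joint laws of the sample and the mechanism randomness are compared. *)
Definition boxes : set (set (funT T m * U)) :=
  [set E | exists B C, [/\ forall i, measurable (B i), measurable C & E = box B C]].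

Lemma measurable_box B C : (forall i, measurable (B i)) -> measurable C ->
  measurable (box B C).
Proof.
move=> mB mC.
have -> : box B C =
    (\bigcap_(i in [set: 'I_m]) ((fun x => x.1 i) @^-1` B i)) `&` snd @^-1` C.
  by apply/seteqP; split => x [xB xC]; split => // i; [move=> _|]; exact: xB.
apply: measurableI.
  apply: fin_bigcap_measurable => [|i _]; first exact: finite_finset.
  rewrite -[X in measurable X]setTI.
  exact: (measurableT_comp (measurable_coord i) measurable_fst).
by rewrite -[X in measurable X]setTI; exact: measurable_snd.
Qed.

Lemma setI_closed_boxes : setI_closed boxes.
Proof.
move=> _ _ [B [C [mB mC ->]]] [B' [C' [mB' mC' ->]]].
exists (fun i => B i `&` B' i), (C `&` C'); split.
- by move=> i; exact: measurableI.
- exact: measurableI.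
- apply/seteqP; split=> x /=; rewrite /box/=.
    by move=> [[xB xC] [xB' xC']].
  by move=> [xB [xC xC']]; split; split => // i; have [] := xB i.
Qed.

(** The product sigma-algebra is the smallest one making both projections measurable, and both are
    measurable for the one generated by boxes. *)
Lemma measurable_boxes : @measurable _ (funT T m * U)%type = <<s boxes >>.
Proof.
apply/seteqP; split; last first.
  apply: smallest_sub; first exact: sigma_algebra_measurable.
  by move=> _ [B [C [mB mC ->]]]; exact: measurable_box.
have m1 : measurable_fun setT (fst : g_sigma_algebraType boxes -> funT T m).
  apply: measurable_fun_coordP => i _ B mB; rewrite setTI.
  apply: sub_sigma_algebra; exists (fun j => if j == i then B else setT), setT; split=> //.
    by move=> j; case: ifP.
  apply/seteqP; split=> x /=.
    by move=> xB; split => // j; case: eqP => // ->.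
  by move=> [/(_ i)]; rewrite eqxx.
have m2 : measurable_fun setT (snd : g_sigma_algebraType boxes -> U).
  move=> _ C mC; rewrite setTI.
  apply: sub_sigma_algebra; exists (fun=> setT), C; split=> //.
  by apply/seteqP; split=> x //= [].
apply: smallest_sub; first exact: smallest_sigma_algebra.
rewrite subUset; split => _ [B mB <-]; [exact: m1|exact: m2].
Qed.

End cylinder_sigma_algebra.

Section iid_sample.
Context {R : realType} {d : measure_display} {Omega : measurableType d}.
Variable P : probability Omega R.
Context {dT : measure_display} {T : measurableType dT}.
Context {dU : measure_display} {U : measurableType dU} {m : nat}.
Variables (Z : 'I_m -> Omega -> T) (xi : Omega -> U).
Hypotheses (mZ : forall i, measurable_fun setT (Z i)) (mxi : measurable_fun setT xi).
Hypothesis indep : forall (B : 'I_m -> set T) (C : set U),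
  (forall i, measurable (B i)) -> measurable C ->
  P [set w | (forall i, B i (Z i w)) /\ C (xi w)] =
  (\prod_(i < m) P (Z i @^-1` B i) * P (xi @^-1` C))%E.

Let sample (pi : 'S_m) (w : Omega) : funT T m := fun i => Z (pi i) w.

Let msample pi : measurable_fun setT (sample pi).
Proof. by apply: measurable_fun_coordP => i; exact: mZ. Qed.

Let sampleX pi (w : Omega) : funT T m * U := (sample pi w, xi w).

Let msampleX pi : measurable_fun setT (sampleX pi).
Proof. by apply: measurable_fun_pair. Qed.

Let msampleRV pi : {mfun Omega >-> funT T m} :=
  HB.pack (sample pi) (isMeasurableFun.Build _ _ _ _ (sample pi) (msample pi)).
Let msampleXRV pi : {mfun Omega >-> (funT T m * U)%type} :=
  HB.pack (sampleX pi) (isMeasurableFun.Build _ _ _ _ (sampleX pi) (msampleX pi)).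
Let mxiRV : {mfun Omega >-> U} :=
  HB.pack xi (isMeasurableFun.Build _ _ _ _ xi mxi).

Let boxT : boxes (setT : set (funT T m * U)).
Proof.
exists (fun=> setT), setT; split => //.
by apply/seteqP; split => x.
Qed.

Let sample_product (E : set (funT T m * U)) : measurable E ->
  P (sampleX 1 @^-1` E) = (distribution P (msampleRV 1) \x distribution P mxiRV)%E E.
Proof.
move=> mE; transitivity (distribution P (msampleXRV 1) E); first by [].
apply: (measure_unique boxes (fun=> setT)) => //.
- exact: measurable_boxes.
- exact: setI_closed_boxes.
- by rewrite bigcup_const.
- move=> _ [B [C [mB mC ->]]].
  pose A : set (funT T m) := [set D | forall i, B i (D i)].
  have mA : measurable A.
    have -> : A = \bigcap_(i in [set: 'I_m]) ((fun D : funT T m => D i) @^-1` B i).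
      by apply/seteqP; split => x xB i; [move=> _|]; exact: xB.
    apply: fin_bigcap_measurable => [|i _]; first exact: finite_finset.
    by rewrite -[X in measurable X]setTI; exact: measurable_coord.
  have -> : box B C = A `*` C by apply/seteqP; split=> x.
  transitivity (distribution P (msampleRV 1) A * distribution P mxiRV C)%E.
    rewrite /distribution /pushforward/=.
    (* Independence with the whole space in place of [C] gives the law of the sample alone. *)
    have -> : sample 1 @^-1` A = [set w | (forall i, B i (Z i w)) /\ setT (xi w)].
      apply/seteqP; split => w /=.
        by move=> Aw; split => // i; have := Aw i; rewrite /sample perm1.
      by move=> [Bw _] i; rewrite /sample perm1.
    rewrite indep// preimage_setT probability_setT mule1 -indep//; congr (P _).
    apply/seteqP; split => w /=.
      by move=> [Aw Cw]; split => // i; have := Aw i; rewrite /sampleX/sample/= perm1.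
    by move=> [Bw Cw]; split => // i; rewrite /sampleX/sample/= perm1.
  by apply/esym; exact: product_measure1E.
- by move=> _; rewrite /= probability_setT ltry.
Qed.

Hypothesis ident : forall i j (B : set T), measurable B ->
  P (Z i @^-1` B) = P (Z j @^-1` B).

Let sample_perm pi (E : set (funT T m * U)) : measurable E ->
  P (sampleX pi @^-1` E) = P (sampleX 1 @^-1` E).
Proof.
move=> mE; transitivity (distribution P (msampleXRV pi) E); first by [].
transitivity (distribution P (msampleXRV 1) E); last by [].
apply: (measure_unique boxes (fun=> setT)) => //.
- exact: measurable_boxes.
- exact: setI_closed_boxes.
- by rewrite bigcup_const.
- have law p (B : 'I_m -> set T) (C : set U) : (forall i, measurable (B i)) -> measurable C ->
      distribution P (msampleXRV p) (box B C) =
      (\prod_(i < m) P (Z i @^-1` B i) * P (xi @^-1` C))%E.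
    move=> mB mC.
    (* Entry [i] of the permuted sample is [Z (p i)], so the constraint falling on [Z i] is the one
       indexed by the inverse image of [i]. Identical distribution then permits the reindexing. *)
    transitivity (\prod_(i < m) P (Z i @^-1` B ((p^-1)%g i)) * P (xi @^-1` C))%E.
      rewrite -indep//; congr (P _); apply/seteqP; split => w.
        move=> [Bw Cw]; split => // i; have := Bw ((p^-1)%g i).
        by rewrite /= /sample permKV.
      move=> [Bw Cw]; split => // i; have := Bw (p i).
      by rewrite permK.
    congr (_ * _)%E; rewrite (reindex_inj (@perm_inj _ p))/=.
    by apply: eq_bigr => i _; rewrite permK; exact: ident.
  by move=> _ [B [C [mB mC ->]]]; exact: etrans (law _ _ _ mB mC) (esym (law _ _ _ mB mC)).
- by move=> _; rewrite /= probability_setT ltry.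
Qed.

(* The joint law of the sample and xi is a product law that is invariant under
   permuting the sample, so it is enough to compare the sections at each D. *)
Lemma iid_sample_exchangeable (pi : 'S_m) (E F : set (funT T m * U)) :
  measurable E -> measurable F ->
  (forall D : 'I_m -> T, P (xi @^-1` [set u | E (fun i => D (pi i), u)]) =
                         P (xi @^-1` [set u | F (D, u)])) ->
  P [set w | E (fun i => Z i w, xi w)] = P [set w | F (fun i => Z i w, xi w)].
Proof.
move=> mE mF EF.
have sample1 w : sampleX 1 w = (fun i => Z i w, xi w).
  by rewrite /sampleX; congr pair; apply/funext => i; rewrite /sample perm1.
have -> : [set w | E (fun i => Z i w, xi w)] = sampleX 1 @^-1` E.
  by apply/seteqP; split => w /=; rewrite sample1.
have -> : [set w | F (fun i => Z i w, xi w)] = sampleX 1 @^-1` F.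
  by apply/seteqP; split => w /=; rewrite sample1.
rewrite -(sample_perm pi)//.
(* The permutation moves from the sample to the event; integrating over the sample then reduces the
   claim to the sections at each [D]. *)
pose shuffle (x : funT T m * U) : funT T m * U := (fun i => x.1 (pi i), x.2).
have mshuffle : measurable_fun setT shuffle.
  apply: measurable_fun_pair => //; apply: measurable_fun_coordP => i.
  exact: (measurableT_comp (measurable_coord (pi i)) measurable_fst).
have -> : sampleX pi @^-1` E = sampleX 1 @^-1` (shuffle @^-1` E).
  by apply/seteqP; split => w /=; rewrite sample1.
have mE' : measurable (shuffle @^-1` E).
  by rewrite -[X in measurable X]setTI; exact: mshuffle.
rewrite !sample_product//= /product_measure1.
apply: eq_integral => D _ /=.
have := EF D; rewrite /distribution /pushforward /= => EFD.
have -> : xsection F D = [set u | F (D, u)] by apply/seteqP; split => u /=; rewrite /xsection/= inE.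
by rewrite -EFD; congr (P _); apply/seteqP; split => w; rewrite /= /xsection/= inE.
Qed.

End iid_sample.

(** * The coverage bound *)

(** Used twice: for the data together with the mechanism randomness, and for the noises together
    with the sigma-algebra of data and models. The slot [None] holds the second component. *)
Lemma mutually_independent_option {R : realType} {d : measure_display}
    {Omega : measurableType d} (P : probability Omega R) (I : finType)
    (F : option I -> set (set Omega)) (E : option I -> set Omega) :
  mutually_independent P F -> (forall o, F o (E o)) ->
  P [set w | (forall i, E (Some i) w) /\ E None w] =
  (\prod_i P (E (Some i)) * P (E None))%E.
Proof.
move=> indep FE; have := indep [set: option I]%SET E (fun o _ => FE o).
have inT : (fun o : option I => o \in [set: option I]%SET) =1 xpredT by move=> o; rewrite inE.
rewrite !(eq_bigl _ _ inT) -bigcap_seq => h.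
transitivity (P (\bigcap_(i in [set` index_enum (option I : finType)]) E i)).
  congr (P _); apply/seteqP; split => w.
    by move=> [Ew Ew0] [i|] _.
  by move=> Ew; split => [i|]; apply: Ew; rewrite /= mem_index_enum.
rewrite h (bigD1 None)//= muleC (reindex_omap Some id) => [|[]//].
by congr (_ * _)%E; apply: eq_bigl => i; rewrite eqxx.
Qed.

Lemma expr_bernoulli {R : realType} (t : R) (N : nat) : 0 <= t <= 1 -> 1 - N%:R * t <= (1 - t) ^+ N.
Proof.
move=> /andP[t0 t1]; elim: N => [|N IH]; first by rewrite mul0r subr0 expr0.
rewrite exprS; apply: (@le_trans _ _ ((1 - t) * (1 - N%:R * t))).
  rewrite -natr1; have : 0 <= N%:R * (t * t) by rewrite !mulr_ge0.
  nra.
by rewrite ler_wpM2l// subr_ge0.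
Qed.

(** * From ranks under the larger model to ranks under the smaller one *)

Section rank_coverage.
Context {R : realType} {d : measure_display} {Omega : measurableType d}.
Variables (P : probability Omega R) (n r M : nat) (x y : 'I_n.+1 -> Omega -> R).
Variables (h f delta D : R) (G : set Omega).
Hypotheses (mx : forall i, measurable_fun setT (x i))
  (my : forall i, measurable_fun setT (y i)) (mG : measurable G).
Hypotheses (r0n : (0 < r <= n.+1)%N) (h0 : 0 <= h).
Let q w := kth_smallest (x^~ w) r.
Let wd := widen_ord (leqnSn n).
Hypothesis exch : forall i,
  P [set w | x i w < q w] = P [set w | x ord_max w < q w].
Hypothesis noties : forall i j : 'I_n.+1, i != j -> P [set w | x i w = x j w] = 0%E.
Hypothesis band_above : forall i,
  (P [set w | (q w < x i w <= q w + h)%R] <= (f * h)%:E)%E.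
Hypothesis band_below :
  (P [set w | (q w - h <= x ord_max w < q w)%R] <= (f * h)%:E)%E.
Hypotheses (close : (P (~` G) <= delta%:E)%E)
  (Gxy : forall w, G w -> forall i, `|y i w - x i w| <= h).
(** [D] bounds the Markov quotient [n f h / (M + 1)] for the event of more than [M] points in the
    band. *)
Hypothesis MD : n%:R * (f * h) <= D * M.+1%:R.

Let mq : measurable_fun setT q.
Proof. exact: measurable_kth_smallest. Qed.

Let ties : set Omega :=
  \big[setU/set0]_(p : 'I_n.+1 * 'I_n.+1 | p.1 != p.2) [set w | x p.1 w = x p.2 w].

Let ties_null : measurable ties /\ P ties = 0%E.
Proof.
apply: (big_ind (fun A => measurable A /\ P A = 0%E)).
- by rewrite measure0.
- move=> A B [mA A0] [mB B0]; split; first exact: measurableU.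
  apply/eqP; rewrite eq_le measure_ge0 andbT.
  apply: (@le_trans _ _ (P A + P B)%E); first exact: measureU2.
  by rewrite A0 B0 adde0.
- move=> [i j] /= ij; split; last exact: noties.
  rewrite (_ : [set w | _] = [set w | x i w <= x j w] `&` [set w | x j w <= x i w]).
    by apply: measurableI; exact: measurable_set_le.
  apply/seteqP; split => w /=; first by move=> ->; rewrite lexx.
  by move=> [h1 h2]; apply/eqP; rewrite eq_le h1 h2.
Qed.

Let no_ties w : ~ ties w -> injective (x^~ w).
Proof.
move=> tw i j xij; apply/eqP; apply: contra_notT tw => ij.
rewrite /ties -bigcup_seq_cond; exists (i, j) => //=.
by rewrite mem_index_enum.
Qed.

Let mbelow i : measurable [set w | x i w < q w].
Proof. exact: measurable_set_lt. Qed.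

(** Outside the null event [ties] at least [r - 1] scores lie below [q]. The Markov bound on this
    event of probability one compares [r - 1] with a sum of [n + 1] probabilities, all equal by
    [exch]. *)
Lemma prob_lt_kth_smallest : ((r.-1%:R / n.+1%:R)%:E <= P [set w | (x ord_max w < q w)%R])%E.
Proof.
have [mt t0] := ties_null.
have := @prob_card_markov R d Omega P 'I_n.+1 (fun i w => x i w < q w) (~` ties) r.-1 mbelow
  (measurableC mt).
have /[swap] /[apply] : forall w, (~` ties) w -> (r.-1 <= #|[pred i | (x i w < q w)%R]|)%N.
  move=> w /no_ties xinj; have := card_lt_kth_smallest r0n xinj.
  by rewrite -/(q w); case: (r) => //.
rewrite probability_setC// t0 sube0 mule1 (eq_bigr (fun=> P [set w | (x ord_max w < q w)%R])); last first.
  by move=> i _; exact: exch.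
have /fineK <- : P [set w | (x ord_max w < q w)%R] \is a fin_num.
  exact: fin_num_measure.
rewrite sumEFin !lee_fin sumr_const card_ord => H.
by rewrite ler_pdivrMr ?ltr0n// mulr_natr.
Qed.

Lemma rank_coverage :
  ((r.-1%:R / n.+1%:R - f * h - delta - D)%:E <=
   P [set w | (#|[pred i | (y (wd i) w < y ord_max w)%R]| < r + M)%N])%E.
Proof.
set E := [set w | _].
pose many := [set w | (M.+1 <= #|[pred i | (q w < x (wd i) w <= q w + h)%R]|)%N].
pose below := [set w | q w - h <= x ord_max w < q w].
have [mt t0] := ties_null.
have mab i : measurable [set w | q w < x i w <= q w + h].
  rewrite (_ : [set w | _] = [set w | q w < x i w] `&` [set w | x i w <= q w + h]).
    apply: measurableI; first exact: measurable_set_lt.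
    by apply: measurable_set_le => //; exact: measurable_funD.
  by apply/seteqP; split => w /=; [move/andP|move=> [-> ->]].
have mbe : measurable below.
  rewrite (_ : below = [set w | q w - h <= x ord_max w] `&` [set w | x ord_max w < q w]).
    apply: measurableI => //; apply: measurable_set_le => //; exact: measurable_funB.
  by apply/seteqP; split => w; rewrite /below/=; [move/andP|move=> [-> ->]].
have mmany : measurable many.
  by apply: measurable_set_card_ge => i; exact: mab.
have mE : measurable E.
  by apply: measurable_set_card_lt => i; exact: measurable_set_lt.
have manyD : (P many <= D%:E)%E.
  have := @prob_card_markov R d Omega P 'I_n
    (fun i w => q w < x (wd i) w <= q w + h) many M.+1 (fun i => mab (wd i)) mmany (fun w => id).
  have : (\sum_(i < n) P [set w | (q w < x (wd i) w <= q w + h)%R] <= (n%:R * (f * h))%:E)%E.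
    apply: (@le_trans _ _ (\sum_(i < n) (f * h)%:E)%E).
      by apply: lee_sum => i _; exact: band_above.
    by rewrite sumEFin lee_fin sumr_const card_ord mulr_natl.
  move=> /[swap] /le_trans /[apply].
  have /fineK <- : P many \is a fin_num by exact: fin_num_measure.
  rewrite -EFinM !lee_fin => /le_trans /(_ MD).
  by rewrite [D * _]mulrC ler_pM2l.
(* Outside the four bad events [card_perturbed_lt] applies; the rest is a union bound. *)
have cover : [set w | x ord_max w < q w] `<=` E `|` (below `|` (~` G `|` (many `|` ties))).
  move=> w /= xq.
  have [|xb] := boolP (q w - h <= x ord_max w); first by move=> xb; right; left; rewrite /below/= xb.
  have [Gw|] := pselect (G w); last by right; right; left.
  have [|tw] := pselect (ties w); first by right; right; right; right.
  have [|mw] := pselect (many w); first by right; right; right; left.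
  left; rewrite /E/=; apply: (card_perturbed_lt (x := x^~ w) (y := y^~ w) (h := h)) => //.
  - exact: no_ties.
  - exact: Gxy.
  - by rewrite ltNge.
  - by rewrite leqNgt; apply/negP.
have mGc := measurableC mG.
have m1 := measurableU _ _ mmany mt.
have m2 := measurableU _ _ mGc m1.
have m3 := measurableU _ _ mbe m2.
have m4 := measurableU _ _ mE m3.
have : (P [set w | (x ord_max w < q w)%R] <= P E + ((f * h)%:E + (delta%:E + (D%:E + 0))))%E.
  apply: (@le_trans _ _ (P (E `|` (below `|` (~` G `|` (many `|` ties)))))).
    by apply: le_measure; rewrite ?inE.
  apply: le_trans (measureU2 _ mE m3) _; apply: leeD2l.
  apply: le_trans (measureU2 _ mbe m2) _; apply: leeD => //.
  apply: le_trans (measureU2 _ mGc m1) _; apply: leeD => //.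
  apply: le_trans (measureU2 _ mmany mt) _; apply: leeD => //.
  by move/eqP: t0; rewrite eq_le => /andP[].
move=> /(le_trans prob_lt_kth_smallest).
have /fineK <- : P E \is a fin_num by exact: fin_num_measure.
rewrite adde0 -!EFinD !lee_fin; move: (_ / _) (fine _) => c e. lra.
Qed.

End rank_coverage.

(** * Training and scoring as measurable maps *)

Definition coordinates (R : realType) (p : nat) : set (set 'rV[R]_p) :=
  [set E | exists (j : 'I_p) (B : set R),
     measurable B /\ E = (fun v : 'rV[R]_p => v ord0 j) @^-1` B].

Arguments coordinates R p : clear implicits.

(* 'rV[R]_p with the sigma-algebra [rV_borel p] of the statement. *)
Notation paramT R p := (g_sigma_algebraType (coordinates R p)).

(** Translates the measurability assumptions of the theorem into measurability on product types. *)
Lemma prod_salgE {d1 d2} {T1 : measurableType d1} {T2 : measurableType d2} :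
  prod_salg (@measurable _ T1) (@measurable _ T2) = @measurable _ (T1 * T2)%type.
Proof.
rewrite measurable_prod_measurableType; congr (<<s _ >>).
apply/seteqP; split => [_ [B [C [mB [mC ->]]]]|_ [B mB [C mC <-]]].
  by exists B => //; exists C.
by exists B, C.
Qed.

Section training.
Context {R : realType} {dT : measure_display} {T : measurableType dT}.
Context {dU : measure_display} {U : measurableType dU} {p m : nat}.
Variables (train : ('I_m -> T) -> U -> 'rV[R]_p) (s : T -> 'rV[R]_p -> R).
Hypothesis mtrain : forall (j : 'I_p) (B : set R), measurable B ->
  prod_salg (cyl_salg T m) (@measurable _ U)
    ((fun x : ('I_m -> T) * U => train x.1 x.2 ord0 j) @^-1` B).
Hypothesis ms : forall B : set R, measurable B ->
  prod_salg (@measurable _ T) (rV_borel p)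
    ((fun x : T * 'rV[R]_p => s x.1 x.2) @^-1` B).

Lemma measurable_train :
  measurable_fun setT (fun x : funT T m * U => train x.1 x.2 : paramT R p).
Proof.
apply: (@measurability _ _ _ (paramT R p) setT _ _ erefl).
move=> _ [_ [j [B [mB ->]]] <-]; rewrite setTI -prod_salgE.
exact: mtrain.
Qed.

Lemma measurable_score : measurable_fun setT (fun x : T * paramT R p => s x.1 x.2).
Proof. by move=> _ B mB; rewrite setTI -prod_salgE; exact: ms. Qed.

Lemma measurable_param_coord (j : 'I_p) :
  measurable_fun setT (fun v : paramT R p => (v : 'rV[R]_p) ord0 j).
Proof. by move=> _ B mB; rewrite setTI; apply: sub_sigma_algebra; exists j, B. Qed.

Lemma measurable_score_comp {dX} {X : measurableType dX} (z : X -> T) (theta : X -> paramT R p) :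
  measurable_fun setT z -> measurable_fun setT theta ->
  measurable_fun setT (fun x => s (z x) (theta x)).
Proof.
move=> mz mtheta.
exact: (measurableT_comp measurable_score (measurable_fun_pair mz mtheta)).
Qed.

Lemma measurable_train_comp {dX} {X : measurableType dX} (Z : 'I_m -> X -> T) (xi : X -> U) :
  (forall i, measurable_fun setT (Z i)) -> measurable_fun setT xi ->
  measurable_fun setT (fun x => train (fun i => Z i x) (xi x) : paramT R p).
Proof.
move=> mZ mxi.
have mZv : measurable_fun setT (fun x => (fun i => Z i x) : funT T m).
  exact: measurable_fun_coordP.
exact: (measurableT_comp measurable_train (measurable_fun_pair mZv mxi)).
Qed.

(** As [c] is nonnegative, squaring removes the root and leaves a polynomial in the coordinates. *)
Lemma measurable_l2norm_gt {dX} {X : measurableType dX} (theta theta' : X -> paramT R p) (c : R) : 0 <= c ->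
  measurable_fun setT theta -> measurable_fun setT theta' ->
  measurable [set x | c < l2norm ((theta x : 'rV[R]_p) - theta' x)].
Proof.
move=> c0 mt mt'.
have coord (t : X -> paramT R p) j : measurable_fun setT t ->
    measurable_fun setT (fun x => (t x : 'rV[R]_p) ord0 j).
  by move=> mt0; exact: (measurableT_comp (measurable_param_coord j) mt0).
have -> : [set x | c < l2norm ((theta x : 'rV[R]_p) - theta' x)] =
    [set x | c ^+ 2 < \sum_(j < p)
      ((theta x : 'rV[R]_p) ord0 j - (theta' x : 'rV[R]_p) ord0 j) ^+ 2].
  rewrite /l2norm; apply/funext => x; congr (is_true _).
  under [in LHS]eq_bigr do rewrite !mxE.
  by rewrite ltNge -[X in _ <= X]ger0_norm// -sqrtr_sqr ler_sqrt ?sqr_ge0// -ltNge.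
apply: measurable_set_lt => //; apply: measurable_sum => j; apply: measurable_funX.
by apply: measurable_funB; exact: coord.
Qed.

(** For fixed data [D], swapping entries [i] and [j] does not change the law of the trained
    parameter, and the order statistic is symmetric in the scores. Hence the two events have equally
    probable sections at [D]. *)
Lemma score_rank_exchangeable {d} {Omega : measurableType d} (P : probability Omega R)
    (Z : 'I_m -> Omega -> T) (xi : Omega -> U) (r : nat) :
  (forall i, measurable_fun setT (Z i)) -> measurable_fun setT xi ->
  (forall (B : 'I_m -> set T) (C : set U),
    (forall i, measurable (B i)) -> measurable C ->
    P [set w | (forall i, B i (Z i w)) /\ C (xi w)] =
    (\prod_(i < m) P (Z i @^-1` B i) * P (xi @^-1` C))%E) ->
  (forall i j (B : set T), measurable B -> P (Z i @^-1` B) = P (Z j @^-1` B)) ->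
  (forall (D : 'I_m -> T) (pi : 'S_m) (B : set 'rV[R]_p), rV_borel p B ->
     P (xi @^-1` ((fun u => train (fun i => D (pi i)) u) @^-1` B)) =
     P (xi @^-1` ((fun u => train D u) @^-1` B))) ->
  (0 < r <= m)%N ->
  let S := fun i w => s (Z i w) (train (fun j => Z j w) (xi w)) in
  forall i j,
  P [set w | S i w < kth_smallest (S^~ w) r] = P [set w | S j w < kth_smallest (S^~ w) r].
Proof.
move=> mZ mxi indep ident inv rm S i j.
pose below k : set (funT T m * U) := [set x |
  s (x.1 k) (train x.1 x.2) < kth_smallest (fun l => s (x.1 l) (train x.1 x.2)) r].
have mbelow k : measurable (below k).
  have msc l : measurable_fun setT (fun x : funT T m * U => s (x.1 l) (train x.1 x.2)).
    exact: (measurable_score_comp (measurableT_comp (measurable_coord l) measurable_fst)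
      measurable_train).
  by apply: measurable_set_lt => //; exact: measurable_kth_smallest.
rewrite -[LHS]/(P [set w | below i (fun k => Z k w, xi w)]).
rewrite -[RHS]/(P [set w | below j (fun k => Z k w, xi w)]).
apply: (iid_sample_exchangeable mZ mxi indep ident (pi := tperm i j)) => // D.
pose B : set 'rV[R]_p := [set th | s (D j) th < kth_smallest (fun l => s (D l) th) r].
have mB : rV_borel p B.
  have msD t : measurable_fun setT (fun th : paramT R p => s t th).
    exact: (measurable_fun_pair2 t measurable_score).
  apply: (@measurable_set_lt R _ (paramT R p)) => //.
  exact: (@measurable_kth_smallest R _ (paramT R p)).
rewrite -(inv D (tperm i j) B mB); congr (P _); apply/seteqP.
by split => w; rewrite /below/B/= tpermL (kth_smallest_perm r (fun l => s (D l) _)).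
Qed.

End training.

Lemma noise_prob_ge {R : realType} {d : measure_display} {Omega : measurableType d}
    (P : probability Omega R) (N : nat) (W : 'I_N -> Omega -> R) (sigma beta : R) :
  (forall k (B : set R), measurable B -> P (W k @^-1` B) = normal_prob 0 sigma B) ->
  0 < beta < 1 -> 0 < sigma -> (0 < N)%N ->
  ((1 - beta)%:E <=
   \prod_k P (W k @^-1` [set x | (x < sigma * Phiinv (1 - beta / N%:R))%R]))%E.
Proof.
move=> WN /andP[b0 b1] s0 N0.
set c := sigma * _.
have Nr0 : 0 < N%:R :> R by rewrite ltr0n.
have bN0 : 0 < beta / N%:R by rewrite divr_gt0.
have bN1 : beta / N%:R < 1.
  by rewrite ltr_pdivrMr// mul1r (lt_le_trans b1)// ler1n.
have mc : measurable [set x : R | x < c] by exact: measurable_set_lt.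
have := @normal_prob_lt_quantile R sigma (1 - beta / N%:R) s0.
rewrite -/c => /(_ _)/wrap[].
  by rewrite subr_gt0 bN1 gtrBl.
have /fineK <- : normal_prob 0 sigma [set x : R | (x < c)%R] \is a fin_num.
  exact: fin_num_measure.
rewrite lee_fin; set pr := fine _ => prE.
rewrite (eq_bigr (fun=> pr%:E)) => [|k _]; last first.
  by rewrite WN// /pr fineK// fin_num_measure.
rewrite prodEFin lee_fin prodr_const card_ord.
(* Each factor is at least [1 - beta / N]; Bernoulli's inequality with [t = beta / N] concludes. *)
apply: (@le_trans _ _ ((1 - beta / N%:R) ^+ N)).
  have -> : 1 - beta = 1 - N%:R * (beta / N%:R) by rewrite mulrC divfK// gt_eqF.
  by apply: expr_bernoulli; rewrite !ltW.
have q0 : 0 <= 1 - beta / N%:R by rewrite subr_ge0 ltW.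
by apply: lerXn2r => //; rewrite nnegrE (le_trans q0).
Qed.

Lemma conf_rank_ge {R : realType} (alpha : R) (n : nat) :
  (1 - alpha) * n.+1%:R <= (conf_rank alpha n)%:R.
Proof.
rewrite /conf_rank natr_absz; apply: le_trans (ceil_ge _) _.
by rewrite ler_int ler_norm.
Qed.

Lemma conf_rank_gt0 {R : realType} (alpha : R) (n : nat) :
  alpha < 1 -> (0 < conf_rank alpha n)%N.
Proof.
move=> a1; rewrite -(ltr0n R); apply: lt_le_trans (conf_rank_ge _ _).
by rewrite mulr_gt0 ?ltr0n// subr_gt0.
Qed.

Lemma absz_ceil_ge {R : realType} (x : R) : x <= `|Num.ceil x|%N%:R.
Proof. by rewrite natr_absz (le_trans (ceil_ge x))// ler_int ler_norm. Qed.

(** Bounds the buffer from below when the quantity being rounded is negative: the absolute value is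
    at least minus the ceiling, which exceeds [- x - 1]. *)
Lemma absz_ceil_gt {R : realType} (x : R) : - x < `|Num.ceil x|%N%:R + 1.
Proof.
rewrite natr_absz; have /andP[+ _] := ceil_itv x; rewrite intrB.
have : - (Num.ceil x)%:~R <= `|Num.ceil x|%:~R :> R by rewrite -intrN ler_int -normrN ler_norm.
lra.
Qed.

(** * Assembly of the coverage guarantee *)

Theorem theorem3
  (R : realType)
  (* common probability space *)
  (d : measure_display) (Omega : measurableType d) (P : probability Omega R)
  (* data space, data Z_1, ..., Z_{n+1} (indexed 0, ..., n) *)
  (dT : measure_display) (T : measurableType dT) (n : nat)
  (Z : 'I_n.+1 -> Omega -> T)
  (* parameter space R^p; training mechanism A with internal randomness xi *)
  (p : nat) (dU : measure_display) (U : measurableType dU)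
  (A : forall m : nat, ('I_m -> T) -> U -> 'rV[R]_p) (xi : Omega -> U)
  (* non-conformity score *)
  (s : T -> 'rV[R]_p -> R)
  (* privacy noise of Algorithm 2 *)
  (N : nat) (W : 'I_N -> Omega -> R)
  (* parameters *)
  (alpha beta sigma a b un deltan L fbar rho : R) :
  let theta_n : Omega -> 'rV[R]_p :=
    fun w => A n (fun i : 'I_n => Z (widen_ord (leqnSn n) i) w) (xi w) in
  let theta_n1 : Omega -> 'rV[R]_p :=
    fun w => A n.+1 (fun i : 'I_n.+1 => Z i w) (xi w) in
  let Sn : 'I_n.+1 -> Omega -> R := fun i w => s (Z i w) (theta_n w) in
  let Sn1 : 'I_n.+1 -> Omega -> R := fun i w => s (Z i w) (theta_n1 w) in
  let r := conf_rank alpha n in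
  let qstar : Omega -> R := fun w => kth_smallest (fun i => Sn1 i w) r in
  let mn := `|Num.ceil (n%:R * fbar * L * un / deltan)|%N in
  let qhat : Omega -> R := fun w =>
    buffered_dp_rbs (fun i : 'I_n => Sn (widen_ord (leqnSn n) i) w)
      a b alpha mn N sigma beta (fun k => W k w) in
  (* measurability of the random elements and of the maps involved *)
  (forall i, measurable_fun setT (Z i)) ->
  measurable_fun setT xi ->
  (forall k, measurable_fun setT (W k)) ->
  (forall (m : nat) (j : 'I_p) (B : set R), (m = n \/ m = n.+1) -> measurable B ->
     prod_salg (cyl_salg T m) (@measurable _ U)
       ((fun x : ('I_m -> T) * U => A m x.1 x.2 ord0 j) @^-1` B)) ->
  (forall B : set R, measurable B ->
     prod_salg (@measurable _ T) (rV_borel p)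
       ((fun x : T * 'rV[R]_p => s x.1 x.2) @^-1` B)) ->
  (* Z_1, ..., Z_{n+1} i.i.d. and the mechanism randomness independent of them *)
  mutually_independent P
    (fun o : option 'I_n.+1 =>
       match o with Some i => rv_salg (Z i) | None => rv_salg xi end) ->
  (forall i (B : set T), measurable B ->
     P (Z i @^-1` B) = P (Z ord0 @^-1` B)) ->
  (* permutation invariance of the training mechanism *)
  (forall (m : nat) (D : 'I_m -> T) (pi : 'S_m) (B : set 'rV[R]_p),
     rV_borel p B ->
     P (xi @^-1` ((fun u => A m (fun i => D (pi i)) u) @^-1` B)) =
     P (xi @^-1` ((fun u => A m D u) @^-1` B))) ->
  (* noise: Z_k ~ N(0, sigma^2), independent of data, models, previous noise *)
  mutually_independent P
    (fun o : option 'I_N =>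
       match o with
       | Some k => rv_salg (W k)
       | None => <<s (\bigcup_(i in setT) rv_salg (Z i)) `|`
                      rvec_salg theta_n `|` rvec_salg theta_n1 >>
       end) ->
  (forall k (B : set R), measurable B ->
     P (W k @^-1` B) = normal_prob 0 sigma B) ->
  (* parameter ranges *)
  0 < alpha < 1 -> 0 < beta < 1 -> 0 < sigma -> (0 < N)%N ->
  (* (A1) *)
  0 < un -> 0 < deltan < 1 ->
  (P [set w | (un < l2norm (theta_n1 w - theta_n w))%R] <= deltan%:E)%E ->
  (* (A2) *)
  (forall z th th', `|s z th - s z th'| <= L * l2norm (th - th')) ->
  (* (A3) *)
  (forall i j : 'I_n.+1, i != j -> P [set w | Sn1 i w = Sn1 j w] = 0%E) ->
  (* (A4) *)
  0 < rho ->
  (forall (delta : R) (i : 'I_n.+1), 0 < delta <= rho ->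
     (P [set w | (qstar w < Sn1 i w <= qstar w + delta)%R] <= (fbar * delta)%:E)%E /\
     (P [set w | (qstar w - delta <= Sn1 i w < qstar w)%R] <= (fbar * delta)%:E)%E) ->
  (* range upper end and buffer conditions *)
  (forall w (i : 'I_n), Sn (widen_ord (leqnSn n) i) w <= b) ->
  L * un <= rho ->
  (r + mn <= n)%N ->
  (P [set w | (Sn ord_max w <= qhat w)%R] >=
    ((1 - beta) * (1 - alpha - 2 * fbar * L * un - 3 * deltan - n.+1%:R^-1))%:E)%E.
Proof.
move=> theta_n theta_n1 Sn Sn1 r qstar mn qhat mZ mxi mW mA ms indepZ ident inv.
move=> indepW lawW /andP[a0 a1] beta01 s0 N0 un0 /andP[d0 d1] A1 A2 A3 rho0 A4 Sb Lrho rmn.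
pose wd := widen_ord (leqnSn n).
have r0 : (0 < r)%N by exact: conf_rank_gt0.
have rn : (0 < r <= n.+1)%N.
  by rewrite r0 (leq_trans (leq_addr mn r))// (leq_trans rmn).
(* A probability bounded by [fbar * rho] with [rho > 0] forces [fbar] to be nonnegative. *)
have f0 : 0 <= fbar.
  have /(A4 rho ord0)[+ _] : 0 < rho <= rho by rewrite rho0 lexx.
  by move=> /(le_trans (measure_ge0 _ _)); rewrite lee_fin pmulr_lge0.
have mthn : measurable_fun setT (theta_n : Omega -> paramT R p).
  by apply: (measurable_train_comp (fun j B => mA n j B (or_introl erefl))).
have mthn1 : measurable_fun setT (theta_n1 : Omega -> paramT R p).
  exact: (measurable_train_comp (fun j B => mA n.+1 j B (or_intror erefl))).
have mSn i : measurable_fun setT (Sn i) by exact: measurable_score_comp.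
have mSn1 i : measurable_fun setT (Sn1 i) by exact: measurable_score_comp.
have exch i : P [set w | Sn1 i w < qstar w] = P [set w | Sn1 ord_max w < qstar w].
  apply: (score_rank_exchangeable (train := A n.+1) (s := s)
    (fun j B => mA n.+1 j B (or_intror erefl)) ms mZ mxi) => //.
  - move=> B C mB mC.
    have := mutually_independent_option (E := fun o => if o is Some i then Z i @^-1` B i else xi @^-1` C) indepZ.
    by apply; case => [k|]; [exists (B k)|exists C].
  - by move=> k l B mB; rewrite ident// [RHS]ident.
  - by move=> D pi B mB; exact: inv.
pose far := [set w | un < l2norm (theta_n1 w - theta_n w)].
have mfar : measurable far by apply: measurable_l2norm_gt => //; exact: ltW.
pose E := [set w | (#|[pred i | (Sn (wd i) w < Sn ord_max w)%R]| < r + mn)%N].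
have covE : ((1 - alpha - 2 * fbar * L * un - 3 * deltan - n.+1%:R^-1)%:E <= P E)%E.
  have arank : 1 - alpha - n.+1%:R^-1 <= r.-1%:R / n.+1%:R.
    have := conf_rank_ge alpha n; rewrite -/r -(prednK r0) -[X in _ <= X]natr1 => ar.
    have n0 : 0 < n.+1%:R :> R by rewrite ltr0n.
    rewrite ler_pdivlMr// mulrBl mulVf ?gt_eqF//; move: ar.
    by move: (r.-1%:R : R) (_ * _) => u v; lra.
  have unV : fbar * (L * un) = 2 * fbar * L * un - fbar * (L * un) by ring.
  have nf : n%:R * fbar * L * un / deltan * deltan = n%:R * (fbar * (L * un)).
    by rewrite divfK ?gt_eqF// !mulrA.
  have norm0 v : 0 <= @l2norm R p v by exact: sqrtr_ge0.
  (* L < 0 is possible when p = 0; then y = x, so h = D = 0 can be used, and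
     r + mn <= n makes - fbar * L * un at most deltan. *)
  have cov h D : 0 <= h -> h <= rho ->
      (forall w, ~ far w -> L * l2norm (theta_n w - theta_n1 w) <= h) ->
      n%:R * (fbar * h) <= D * mn.+1%:R ->
      ((r.-1%:R / n.+1%:R - fbar * h - deltan - D)%:E <= P E)%E.
    move=> h0 hrho close hD.
    have band i : (P [set w | (qstar w < Sn1 i w <= qstar w + h)%R] <= (fbar * h)%:E)%E /\
                  (P [set w | (qstar w - h <= Sn1 i w < qstar w)%R] <= (fbar * h)%:E)%E.
      (* The density assumption speaks only of positive widths; for [h = 0] both bands are empty. *)
      have [h_gt0|] := ltP 0 h; first by apply: A4; rewrite h_gt0.
      move=> hle; have -> : h = 0 by apply/eqP; rewrite eq_le hle.
      rewrite mulr0; split.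
        rewrite [X in P X](_ : _ = set0) ?measure0//.
        by apply/seteqP; split => w //=; rewrite addr0; case: ltP => //= /lt_geF ->.
      rewrite [X in P X](_ : _ = set0) ?measure0//.
      by apply/seteqP; split => w //=; rewrite subr0; case: ltP => //=; rewrite andbF.
    apply: (@rank_coverage R d Omega P n r mn Sn1 Sn h fbar deltan D (~` far)) => //.
    - exact: measurableC.
    - by move=> i; have [] := band i.
    - by have [] := band ord_max.
    - by rewrite setCK.
    - by move=> w nfar i; apply: le_trans (close w nfar); exact: A2.
  have l2normN v v' : @l2norm R p (v - v') = l2norm (v' - v).
    rewrite /l2norm; congr Num.sqrt; apply: eq_bigr => j _.
    by rewrite !mxE -sqrrN opprB.
  have [L0|L0] := leP 0 L.
    have Lun0 : 0 <= L * un by rewrite mulr_ge0// ltW.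
    (* With [h = L * un] and [D = deltan], the choice of [mn] as a ceiling gives
       [n fbar h <= deltan * mn]. The loss [fbar h + 2 deltan] is within the claimed one. *)
    apply: le_trans (cov (L * un) deltan Lun0 Lrho _ _).
    - rewrite lee_fin; have := mulr_ge0 f0 Lun0; move: arank unV.
      by move: (n.+1%:R^-1) (2 * fbar * L * un) (fbar * (L * un)) (_ / _) => x1 x2 x3 x4; lra.
    - move=> w /negP; rewrite -leNgt => unw.
      by rewrite l2normN ler_wpM2l.
    - rewrite -nf mulrC ler_wpM2l ?(ltW d0)//.
      by rewrite (le_trans (absz_ceil_ge _))// ler_nat.
  apply: le_trans (cov 0 0 (lexx _) (ltW rho0) _ _).
  - have n0 : 0 < n%:R :> R.
      by rewrite ltr0n (leq_trans _ rmn)// (leq_trans r0)// leq_addr.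
    (* Since [r >= 1], the buffer condition yields [mn + 1 <= n], while [mn + 1] exceeds
       [- n fbar L un / deltan]. *)
    have fLun : - (fbar * (L * un)) <= deltan.
      rewrite -(ler_pM2l n0) mulrN -nf -mulNr ler_wpM2r ?(ltW d0)//.
      apply: ltW; apply: lt_le_trans (absz_ceil_gt _) _.
      rewrite natr1 ler_nat -/mn; apply: leq_trans rmn.
      by rewrite -add1n leq_add2r.
    rewrite lee_fin mulr0 !subr0; move: arank unV fLun.
    by move: (n.+1%:R^-1) (2 * fbar * L * un) (fbar * (L * un)) (_ / _) => x1 x2 x3 x4; lra.
  - by move=> w _; rewrite mulr_le0_ge0// ltW.
  - by rewrite mulr0 mul0r mulr0.
pose c := sigma * Phiinv (1 - beta / N%:R).
pose G := <<s (\bigcup_(i in setT) rv_salg (Z i)) `|` rvec_salg theta_n `|` rvec_salg theta_n1 >>.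
have GE : G E.
  (* The sample space is given the smaller sigma-algebra of data and models; measurability of the
     scores there makes [E] independent of the noises. *)
  pose OmegaG := g_sigma_algebraType
    ((\bigcup_(i in setT) rv_salg (Z i)) `|` rvec_salg theta_n `|` rvec_salg theta_n1).
  have mZG i : measurable_fun setT (Z i : OmegaG -> T).
    move=> _ B mB; rewrite setTI; apply: sub_sigma_algebra; left; left.
    by exists i => //; exists B.
  have mtG : measurable_fun setT (theta_n : OmegaG -> paramT R p).
    move=> _ B mB; rewrite setTI; apply: sub_sigma_algebra; left; right.
    by exists B.
  have mSG i : measurable_fun setT (Sn i : OmegaG -> R) by exact: measurable_score_comp.
  apply: (@measurable_set_card_lt _ OmegaG) => i.
  exact: (@measurable_set_lt R _ OmegaG).
have noiseE : P [set w | (forall k, W k w < c) /\ E w] =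
    (\prod_k P (W k @^-1` [set x | (x < c)%R]) * P E)%E.
  have := mutually_independent_option
    (E := fun o => if o is Some k then W k @^-1` [set x | x < c] else E) indepW.
  apply; case => [k|]; last exact: GE.
  by exists [set x | x < c]; split => //; exact: measurable_set_lt.
have mE : measurable E.
  by apply: measurable_set_card_lt => i; exact: measurable_set_lt.
apply: (@le_trans _ _ (P [set w | (forall k, W k w < c) /\ E w])).
  (* The lower bound for [P E] may be negative, so it is replaced first, against the nonnegative
     factor [1 - beta]. *)
  rewrite noiseE EFinM; apply: (@le_trans _ _ ((1 - beta)%:E * P E)%E).
    by rewrite lee_wpmul2l// lee_fin subr_ge0 ltW//; case/andP: beta01.
  by rewrite lee_wpmul2r//; exact: noise_prob_ge.
apply: le_measure.
- rewrite inE (_ : [set w | _] = (\bigcap_(k in [set: 'I_N]) [set w | W k w < c]) `&` E).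
    apply: measurableI => //; apply: fin_bigcap_measurable => [|k _].
      exact: finite_finset.
    exact: measurable_set_lt.
  by apply/seteqP; split => w /= [Wc Ew]; split => // k; [move=> _|]; exact: Wc.
- rewrite inE; apply: measurable_set_le => //.
  by apply: measurable_buffered_dp_rbs.
(* If [qhat] were below the test score, the at least [r + mn] scores at or below [qhat] would all
   lie strictly below the test score, against [E]. *)
- move=> w /= [Wc]; rewrite /E/= => Ew; rewrite leNgt; apply/negP => qS.
  have := @buffered_dp_rbs_card R n N (fun i => Sn (wd i) w) a b alpha mn sigma beta
    (fun k => W k w) (Sb w) rmn Wc.
  apply/negP; rewrite -ltnNge; apply: leq_ltn_trans Ew.
  apply: subset_leq_card; apply/fintype.subsetP => i; rewrite !inE => /le_lt_trans.
  exact.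
Qed.
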